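(* Let $D$ be an integrally closed integral domain. Then: (a) $\mathrm{Zar}_{\min}(D)$ is a Noetherian space if and only if $\mathrm{Max}(D)$ is a Noetherian space and $\mathrm{Zar}_{\min}(D_M)$ is a Noetherian space for every $M\in\mathrm{Max}(D)$; (b) $\mathrm{Zar}(D)$ is a Noetherian space if and only if $\mathrm{Spec}(D)$ is a Noetherian space and $\mathrm{Zar}(D_M)$ is a Noetherian space for every $M\in\mathrm{Max}(D)$.
   Context: For an integral domain $D$ with quotient field $K$, $\mathrm{Zar}(D)$ is the set of all valuation domains that contain $D$ and have quotient field $K$ (the valuation overrings of $D$), endowed with the Zariski topology: a subbasis of open sets is given by the sets $\{V\in\mathrm{Zar}(D)\mid x_1,\ldots,x_n\in V\}$, as $x_1,\ldots,x_n$ range in $K$. $\mathrm{Zar}_{\min}(D)$ is the subspace of the elements of $\mathrm{Zar}(D)$ that are minimal with respect to containment. $\mathrm{Spec}(D)$ carries the Zariski topology and $\mathrm{Max}(D)$ (the set of maximal ideals) the subspace topology. A topological space is Noetherian if its open sets satisfy the ascending chain condition (equivalently, every subset is compact, where compact does not include Hausdorff). *)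

(* Defs.v *)
From HB Require Import structures.
From mathcomp Require Import all_boot all_order all_algebra.
From mathcomp Require Import all_classical.
From mathcomp Require Import topology.

Set Implicit Arguments.
Unset Strict Implicit.
Unset Printing Implicit Defensive.

Import GRing.Theory.

Local Open Scope classical_set_scope.
Local Open Scope ring_scope.

Definition noetherian_space (T : topologicalType) : Prop :=
  forall U : nat -> set T,
    (forall n, open (U n)) -> (forall n, U n `<=` U n.+1) ->
    exists N, forall n, (N <= n)%N -> U n = U N.

Section ZariskiRiemann.
Variable K : fieldType.
Implicit Types A V : set K.

Definition is_subring V : Prop := subring_closed (mem V).

(* Each nonzero element [a / b] of the quotient field of [V] is in [V] or has
   its inverse in [V]. *)
Definition is_valuation_domain V : Prop :=
  is_subring V /\
  forall a b, V a -> V b -> a != 0 -> b != 0 -> V (a / b) \/ V (b / a).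

Definition is_quotient_field_of V : Prop :=
  forall x : K, exists a b, [/\ V a, V b, b != 0 & x = a / b].

Definition valuation_overring A V : Prop :=
  [/\ is_valuation_domain V, is_quotient_field_of V & A `<=` V].

(* Meant for a subring [A] of [K] whose quotient field is [K]. *)
Record Zar (A : set K) := MkZar {
  zar_set :> set K;
  zar_overring : valuation_overring A zar_set
}.

HB.instance Definition _ A := gen_eqMixin (Zar A).
HB.instance Definition _ A := gen_choiceMixin (Zar A).

Definition zar_basic A (S : set K) : set (Zar A) :=
  [set V : Zar A | S `<=` V].

HB.instance Definition _ A :=
  @isSubBaseTopological.Build (Zar A) (set K) finite_set (@zar_basic A).

(* As a type, [Zar_min A] has the subspace topology (see [set_type]). *)
Definition Zar_min A : set (Zar A) :=
  [set V : Zar A | forall W : Zar A, W `<=` V -> W = V].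

End ZariskiRiemann.

Arguments Zar_min {K} A.

Section Spectrum.
Variable D : idomainType.

(* [idealr_closed] includes properness. *)
Record Spec := MkSpec {
  spec_set :> set D;
  spec_ideal : idealr_closed (mem spec_set);
  spec_prime : prime_idealr_closed (mem spec_set)
}.

HB.instance Definition _ := gen_eqMixin Spec.
HB.instance Definition _ := gen_choiceMixin Spec.

Definition spec_closed_set (S : set D) : set Spec :=
  [set P : Spec | S `<=` P].

Definition spec_open (U : set Spec) : Prop :=
  exists S : set D, U = ~` spec_closed_set S.

Lemma spec_openT : spec_open setT.
Proof.
exists setT; apply/seteqP; split=> // P _ /= sTP.
have [_ + _] := spec_ideal P.
by move/negP; apply; rewrite inE; exact: sTP.
Qed.

Lemma spec_openI : setI_closed spec_open.
Proof.
move=> _ _ [S ->] [S' ->].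
exists [set x | exists a b, [/\ S a, S' b & x = a * b]].
rewrite -setCU; congr (~` _); apply/seteqP; split=> P /=.
  have [_ _ idP] := spec_ideal P.
  have P0 : 0 \in mem (spec_set P) by have [] := spec_ideal P.
  have idMP c x : (P : set D) x -> (P : set D) (c * x).
    move=> /mem_set Px; rewrite -[c * x]addr0.
    by have /set_mem := idP c x 0 Px P0.
  case=> sP _ [a [b [Sa Sb ->]]]; last exact/idMP/sP.
  by rewrite mulrC; exact/idMP/sP.
move=> sP; apply: contrapT => /not_orP[/existsNP[a nPa] /existsNP[b nPb]].
move/not_implyP: nPa => [Sa nPa]; move/not_implyP: nPb => [Sb nPb].
have /mem_set Pab : (P : set D) (a * b) by apply: sP; exists a, b.
by have /orP[/set_mem|/set_mem] := @spec_prime P a b Pab.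
Qed.

Lemma spec_open_bigU (I : Type) (f : I -> set Spec) :
  (forall i, spec_open (f i)) -> spec_open (\bigcup_i f i).
Proof.
move=> /choice[S fE]; exists (\bigcup_i S i).
rewrite (eq_bigcupr (fun i _ => fE i)) -setC_bigcap; congr (~` _).
apply/seteqP; split=> P /= sSP.
  by move=> x [i _ Six]; exact: (sSP i).
by move=> i _ x Six; apply: sSP; exists i.
Qed.

HB.instance Definition _ :=
  @isOpenTopological.Build Spec spec_open spec_openT spec_openI spec_open_bigU.

Definition Max : set Spec :=
  [set M : Spec | forall I : set D,
    idealr_closed (mem I) -> M `<=` I -> I = M].

Definition base_ring : set {fraction D} := range (@tofrac D).

Definition localization (M : Spec) : set {fraction D} :=
  [set x | exists a s, ~ (M : set D) s /\ x = tofrac a / tofrac s].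

Definition integrally_closed : Prop :=
  forall x : {fraction D}, integralOver (@tofrac D) x -> base_ring x.

End Spectrum.

Arguments Max D : clear implicits.
Arguments base_ring D : clear implicits.
Arguments localization {D} M.

(* Main.v *)
Require Import Defs.
From mathcomp Require Import all_boot all_order all_algebra.
From mathcomp Require Import all_classical.
From mathcomp Require Import topology.
From mathcomp Require Import finmap ring.

(** Noetherianity is tested on sequences: a space is Noetherian if and only if
    every sequence converges, along every ultrafilter on [nat], to one of its own
    terms ([noetherian_ultra_cvg], [ultra_cvg_noetherian]). In a space of
    valuation rings [V n], convergence to [V k] means that [V k] lies in the limit
    ring [{x | x in V n for U-almost all n}]; in a space of primes it means that
    [P k] contains the limit prime.

    The valuation rings are produced by Zorn's lemma applied to their sets of
    nonunits: if [J] is maximal among the [B]-submodules of the field that are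
    closed under multiplication and do not contain 1, then [{x | x J <= J}] is a
    valuation ring with nonunits [J], minimal over [B] ([ex_minimal_overring]).
    Consequently minimal valuation overrings of [D] have maximal centers, every
    prime is a center, and the minimal valuation overrings of [D_M] are those of
    [D] centered on [M]. The two direct implications follow, since the center map
    is continuous and surjective and the Zariski space of [D_M] is a subspace of
    that of [D].

    For the converses the key point is local ([noetherian_Zar_min_local]). Let [M]
    be maximal, let the minimal Zariski space of [D_M] be Noetherian, and let [x],
    [x^-1] lie outside [D_M]. Then every [m] in [M] satisfies [m ^+ n * x] in [D_M]
    for some [n]. Otherwise put [y n = m ^+ n * x]. As [D] is integrally closed,
    Seidenberg's lemma makes [M] and [y n - 1] generate a proper ideal of
    [D[y n]], so some minimal valuation overring [V n] has both [m] and [y n - 1]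
    among its nonunits; then [y n] is a unit of [V n] and [y k] is not in [V n]
    for [k < n], so the sequence [V n] has no limit among its terms. It follows
    that a prime [Q] properly contained in [M] satisfies: each [x] lies in [D_Q]
    or has its inverse in [D_M].

    Finally let [V n] be valuation overrings of [D] with centers [P n], and let
    [Q] be the limit prime of the [P n] along [U]. The Noetherian space of primes
    gives [Q <= P n] for almost all [n]. If [P n = Q] for almost all [n], then
    almost all [V n] belong to the Zariski space of one localization [D_M], which
    is Noetherian. Otherwise some [P k] contains [Q] properly, and the local
    result gives [V k <= D_Q]: if [x] in [V k] is not in [D_Q], then [x^-1] lies in
    [D_(P k)], hence so does [x], and [D_(P k)] is contained in [D_Q]. As [D_Q] is
    contained in the limit ring, [V n] converges to [V k] ([noetherian_glue]). *)

Set Implicit Arguments.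
Unset Strict Implicit.
Unset Printing Implicit Defensive.

Import GRing.Theory.

Local Open Scope classical_set_scope.
Local Open Scope ring_scope.

(** * Noetherian spaces and ultrafilters *)

Lemma ultraNP (I : Type) (U : set_system I) (A : set I) :
  UltraFilter U -> U (~` A) <-> ~ U A.
Proof.
move=> UU; split=> [UnA UA|nUA]; last by have [|] := in_ultra_setVsetC A UU.
by apply: (@filter_not_empty _ U); rewrite -(setICr A); apply: filterI.
Qed.

Lemma noetherian_maximal_open (T : topologicalType) (P : set (set T)) :
    noetherian_space T -> P set0 -> P `<=` open ->
  exists2 O, P O & forall O', P O' -> O `<=` O' -> O' `<=` O.
Proof.
move=> noethT P0 Pop; apply: contrapT => noMax.
have next O : exists O', P O -> [/\ P O', O `<=` O' & ~ O' `<=` O].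
  have [PO|?] := pselect (P O); last by exists O.
  apply: contrapT => noO'; apply: noMax; exists O => // O' PO' OO'.
  by apply: contrapT => O'O; apply: noO'; exists O'.
have {next}[f fP] := choice next.
have Pf n : P (iter n f set0) by elim: n => //= n /fP[].
have [N /(_ N.+1 (leqnSn N)) /= fN] := noethT (fun n => iter n f set0)
  (fun n => Pop _ (Pf n)) (fun n => let: And3 _ h _ := fP _ (Pf n) in h).
by have [_ _] := fP _ (Pf N); apply; rewrite fN.
Qed.

(** The sequence avoids, along [U], a largest open set; its terms outside that
    open set are limits. *)
Lemma noetherian_ultra_cvg (T : topologicalType) (p : nat -> T)
    (U : set_system nat) :
  noetherian_space T -> UltraFilter U -> U [set k | p @ U --> p k].
Proof.
move=> noethT UU.
have P0 : open (set0 : set T) /\ ~ U (p @^-1` set0).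
  by split; [exact: open0|rewrite preimage_set0; exact: filter_not_empty].
have [|O [oO nUO] maxO] := noetherian_maximal_open
  (P := [set O | open O /\ ~ U (p @^-1` O)]) noethT P0; first by move=> O [].
move/(ultraNP _ UU): nUO => UnO.
apply: filterS (UnO) => k nOpk A; rewrite nbhsE => -[B [oB Bpk] BA].
apply: (@filterS _ U _ (p @^-1` B)) => [n /BA //|].
apply: contrapT => nUB; apply: nOpk; apply: (maxO (O `|` B)); [|by left|by right].
split; first exact: openU.
apply/(ultraNP _ UU); rewrite preimage_setU setCU; apply: filterI => //.
exact/ultraNP.
Qed.

(** An ascending chain that never stabilises has a sequence of points, the
    [n]-th one outside the [n]-th open set but inside a later one; no
    non-principal ultrafilter makes it converge to one of its terms. *)
Lemma ultra_cvg_noetherian (T : topologicalType) :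
    (forall (p : nat -> T) (U : set_system nat), UltraFilter U ->
       exists k, p @ U --> p k) ->
  noetherian_space T.
Proof.
move=> cvgT O oO incrO; apply: contrapT => noN.
have subO m n : (m <= n)%N -> O m `<=` O n.
  move/subnKC <-; elim: (n - m)%N => [|d IH]; first by rewrite addn0.
  by rewrite addnS; apply: subset_trans IH _; apply: incrO.
have /choice[f /choice[p pP]] N : exists n, exists x, O n x /\ ~ O N x.
  apply: contrapT => noX; apply: noN; exists N => n Nn.
  apply/seteqP; split; last exact: subO.
  by move=> x Onx; apply: contrapT => nONx; apply: noX; exists n, x.
have [U [UU ooU]] := ultraFilterLemma (_ : ProperFilter \oo).
have [k pk] := cvgT p U UU.
have Upk : U (p @^-1` O (f k)).
  by apply: pk; apply: open_nbhs_nbhs; have [] := pP k.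
have Uge : U [set n | (f k <= n)%N] by apply: ooU; exists (f k).
have [n [/= Opn /subO fkn]] := filter_ex (filterI Upk Uge).
by have [_] := pP n; apply; apply: fkn.
Qed.

(** * Zariski spaces as families of subsets of the field *)

Section Family.
Variable K : fieldType.

Definition pointwise_limit (V : nat -> set K) (U : set_system nat) : set K :=
  [set x | U [set n | V n x]].

(** [F] with the topology generated by the sets [{V in F | x in V}] is
    Noetherian; a sequence then converges to [V k] along an ultrafilter exactly
    when [V k] lies in its pointwise limit. *)
Definition noetherian_family (F : set (set K)) : Prop :=
  forall (V : nat -> set K) (U : set_system nat), (forall n, F (V n)) ->
    UltraFilter U -> U [set k | V k `<=` pointwise_limit V U].

Lemma sub_noetherian_family (F G : set (set K)) :
  F `<=` G -> noetherian_family G -> noetherian_family F.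
Proof. by move=> FG noethG V U FV UU; apply: noethG => // n; apply: FG. Qed.

Definition minimal_overring (A : set K) : set (set K) :=
  [set V | valuation_overring A V /\
           forall W, valuation_overring A W -> W `<=` V -> W = V].

Lemma zar_eq A (V W : Zar A) : V = W :> set K -> V = W.
Proof.
case: V W => [V hV] [W hW] /= VW; subst W; congr MkZar; exact: Prop_irrelevance.
Qed.

Lemma zar_cvgP A (V : nat -> Zar A) (U : set_system nat) (W : Zar A) :
  UltraFilter U -> V @ U --> W <-> W `<=` pointwise_limit V U.
Proof.
move=> UU; split=> [VW x Wx|WV O].
  suff : U (V @^-1` [set V' : Zar A | (V' : set K) x]) by [].
  apply: VW.
  apply: open_nbhs_nbhs; split=> //=.
  exists [set [set V' : Zar A | (V' : set K) x]]; last by rewrite bigcup_set1.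
  move=> _ ->; exists [fset [set x]]%fset => [S|].
    by rewrite inE => /eqP ->; exact: (mem_set (finite_set1 x)).
  apply/seteqP; split=> V' /=.
    by move=> /(_ [set x]) /=; rewrite inE => /(_ (eqxx _)); apply.
  by move=> V'x S; rewrite /= inE => /eqP -> _ ->.
rewrite nbhsE => -[B [[D' D'sub <-] [C D'C CW]] BO].
suff UC : U (V @^-1` C) by apply: filterS UC => n VnC; apply: BO; exists C.
have [Ss Ssfin CE] := D'sub _ D'C; rewrite -CE in CW *.
apply: filter_bigI => S SsS.
have /set_mem /= finS := Ssfin _ SsS.
have SW : S `<=` W by exact: (CW S SsS).
suff : U (\bigcap_(x in S) [set n | (V n : set K) x]).
  by apply: filterS => n SV x Sx; exact: SV.
rewrite -(fset_setK finS); apply: filter_bigI => x.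
by rewrite in_fset_set// => /set_mem /SW /WV.
Qed.

Lemma initial_ultra_cvg (S : choiceType) (T : topologicalType) (f : S -> T)
    (p : nat -> initial_topology f) (U : set_system nat)
    (s : initial_topology f) :
  Filter U -> p @ U --> s <-> (f \o p) @ U --> f s.
Proof.
move=> FU; split=> [ps A fsA|fps A].
  suff : U (p @^-1` (f @^-1` A)) by [].
  apply: ps; exact: (@initial_continuous _ _ f s A fsA).
rewrite nbhsE => -[_ [[B oB <-] Bfs] BA].
suff : U (p @^-1` (f @^-1` B)) by apply: filterS => n /BA.
by apply: (fps B); apply: open_nbhs_nbhs.
Qed.

Lemma noetherian_ZarP A :
  noetherian_space (Zar A) <-> noetherian_family (valuation_overring A).
Proof.
split=> noeth.
  move=> V U AV UU.
  apply: filterS (noetherian_ultra_cvg (fun n => MkZar (AV n)) noeth UU) => k.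
  by move/zar_cvgP.
apply: ultra_cvg_noetherian => V U UU.
have /filter_ex[k Vk] := noeth V U (fun n => zar_overring (V n)) UU.
by exists k; apply/zar_cvgP.
Qed.

Lemma noetherian_Zar_minP A :
  noetherian_space (Zar_min A) <-> noetherian_family (minimal_overring A).
Proof.
have cvgP (V : nat -> Zar_min A) U (W : Zar_min A) : UltraFilter U ->
    V @ U --> W <-> val W `<=` pointwise_limit (fun n => val (V n)) U.
  by move=> UU; rewrite -zar_cvgP; exact: (@initial_ultra_cvg _ _ set_val).
split=> noeth.
  move=> V U minV UU.
  have minZ n : Zar_min A (MkZar (minV n).1).
    move=> W WV; apply: zar_eq; apply: (minV n).2 => //; exact: zar_overring.
  pose Z n : Zar_min A := SigSub (mem_set (minZ n)).
  by apply: filterS (noetherian_ultra_cvg Z noeth UU) => k /cvgP.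
apply: ultra_cvg_noetherian => V U UU.
have minV n : minimal_overring A (val (V n)).
  split=> [|W AW WV]; first exact: zar_overring.
  have /set_mem /(_ (MkZar AW) WV) := valP (V n).
  by move/(congr1 (@zar_set _ _)).
have /filter_ex[k Vk] := noeth _ U minV UU.
by exists k; apply/cvgP.
Qed.

End Family.

(** * Spectra and ultrafilters *)

Section SpectrumUltra.
Variable D : idomainType.

(** [X] is Noetherian in the Zariski topology; the elements [a] that lie in
    [P n] for almost all [n] form the limit prime of the sequence. *)
Definition noetherian_primes (X : set (Spec D)) : Prop :=
  forall (P : nat -> Spec D) (U : set_system nat), (forall n, X (P n)) ->
    UltraFilter U ->
  U [set k | forall a, U [set n | (P n : set D) a] -> (P k : set D) a].

Lemma spec_cvgP (P : nat -> Spec D) (U : set_system nat) (Q : Spec D) :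
  UltraFilter U ->
  P @ U --> Q <->
  forall a, U [set n | (P n : set D) a] -> (Q : set D) a.
Proof.
move=> UU; split=> [PQ a Ua|PQ O].
  apply: contrapT => nQa; apply: (@filter_not_empty _ U).
  suff Ub : U (P @^-1` (~` spec_closed_set [set a])).
    by apply: filterS (filterI Ua Ub) => n /= [Pa]; apply => _ ->.
  apply: PQ; apply: open_nbhs_nbhs; split; first by exists [set a].
  by move=> /(_ a erefl).
rewrite nbhsE => -[_ [[S ->] nSQ] CO].
have [a /not_implyP[Sa nQa]] : exists a, ~ (S a -> (Q : set D) a).
  by apply: contrapT => /forallNP SQ; apply: nSQ => a Sa; apply: contrapT => nQa;
     apply: (SQ a) => /(_ Sa).
have Una : U (~` [set n | (P n : set D) a]) by apply/ultraNP => /PQ.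
suff : U (P @^-1` (~` spec_closed_set S)) by apply: filterS => n /CO.
by apply: filterS Una => n nPa SP; apply: nPa; apply: SP.
Qed.

Lemma noetherian_SpecP : noetherian_space (Spec D) <-> noetherian_primes setT.
Proof.
split=> noeth.
  move=> P U _ UU; apply: filterS (noetherian_ultra_cvg P noeth UU) => k.
  by move/spec_cvgP.
apply: ultra_cvg_noetherian => P U UU.
have /filter_ex[k Pk] := noeth P U (fun=> I) UU.
by exists k; apply/spec_cvgP.
Qed.

Lemma noetherian_MaxP : noetherian_space (Max D) <-> noetherian_primes (Max D).
Proof.
have cvgP (P : nat -> Max D) U (Q : Max D) : UltraFilter U ->
    P @ U --> Q <-> forall a, U [set n | (val (P n) : set D) a] ->
                              (val Q : set D) a.
  by move=> UU; rewrite -spec_cvgP; exact: (@initial_ultra_cvg _ _ set_val).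
split=> noeth.
  move=> P U maxP UU.
  pose Z n : Max D := SigSub (mem_set (maxP n)).
  by apply: filterS (noetherian_ultra_cvg Z noeth UU) => k /cvgP.
apply: ultra_cvg_noetherian => P U UU.
have /filter_ex[k Pk] : U [set k | forall a,
    U [set n | (val (P n) : set D) a] -> (val (P k) : set D) a].
  by apply: noeth => // n; apply: set_mem; apply: valP.
by exists k; apply/cvgP.
Qed.

End SpectrumUltra.

(** * Valuation overrings and their maximal ideals *)

Section Valuation.
Variable K : fieldType.
Implicit Types (A B V W J : set K) (x y z : K).

Lemma valuation_overringP A V :
  valuation_overring A V <->
  [/\ A `<=` V, V 1, (forall x y, V x -> V y -> V (x - y)),
      (forall x y, V x -> V y -> V (x * y)) & forall x, V x \/ V x^-1].
Proof.
split=> [[[[V1 VB VM] Vtot] Vquot AV]|[AV V1 VB VM Vtot]].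
  have V0 : V 0.
    by move: (set_mem (VB 1 1 V1 V1)); rewrite subrr.
  split=> //; first exact: set_mem.
  - by move=> x y /mem_set Vx /mem_set Vy; exact: set_mem (VB _ _ Vx Vy).
  - by move=> x y /mem_set Vx /mem_set Vy; exact: set_mem (VM _ _ Vx Vy).
  move=> x; have [->|x0] := eqVneq x 0; first by left.
  have [a [b [Va Vb b0 xE]]] := Vquot x; rewrite xE invf_div.
  by apply: Vtot => //; apply: contra_neq x0 => a0; rewrite xE a0 mul0r.
split=> //.
- split; first by split; [exact: mem_set| |] => x y /set_mem Vx /set_mem Vy;
    apply: mem_set; [exact: VB|exact: VM].
  by move=> a b _ _ _ _; rewrite -(invf_div a b); exact: Vtot.
- move=> x; have [->|x0] := eqVneq x 0.
    by exists 0, 1; split; rewrite ?oner_neq0 ?mul0r// -(subrr 1); exact: VB.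
  have [Vx|Vx] := Vtot x.
    by exists x, 1; split; rewrite ?oner_neq0 ?divr1.
  by exists 1, x^-1; split; rewrite ?invr_eq0// invrK mul1r.
Qed.

Definition nonunits V : set K := [set x | x = 0 \/ ~ V x^-1].

Section OneValuation.
Variables (A V : set K).
Hypothesis valV : valuation_overring A V.

Lemma overring1 : V 1. Proof. by case/valuation_overringP: valV. Qed.

Lemma overringB x y : V x -> V y -> V (x - y).
Proof. by case/valuation_overringP: valV => _ _ VB _ _; exact: VB. Qed.

Lemma overringM x y : V x -> V y -> V (x * y).
Proof. by case/valuation_overringP: valV => _ _ _ VM _; exact: VM. Qed.

Lemma overring_total x : V x \/ V x^-1.
Proof. by case/valuation_overringP: valV. Qed.

Lemma overring0 : V 0. Proof. by rewrite -(subrr 1); exact: overringB overring1 overring1. Qed.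

Lemma overringN x : V x -> V (- x).
Proof. by move=> Vx; rewrite -sub0r; exact: overringB overring0 Vx. Qed.

Lemma overringD x y : V x -> V y -> V (x + y).
Proof. by move=> Vx Vy; rewrite -[y]opprK; apply/overringB/overringN. Qed.

Lemma nonunits_sub : nonunits V `<=` V.
Proof. by move=> x [->|nVx]; [exact: overring0|case: (overring_total x)]. Qed.

Lemma nonunits1 : ~ nonunits V 1.
Proof. by case=> [/eqP|]; rewrite ?oner_eq0// invr1; apply; exact: overring1. Qed.

Lemma nonunitsMl a x : V a -> nonunits V x -> nonunits V (a * x).
Proof.
move=> Va [->|nVx]; first by left; rewrite mulr0.
have [->|a0] := eqVneq a 0; first by left; rewrite mul0r.
right=> Vax; apply: nVx; have := overringM Va Vax.
by rewrite invfM mulrA divff// mul1r.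
Qed.

Lemma nonunitsB x y : nonunits V x -> nonunits V y -> nonunits V (x - y).
Proof.
move=> mx my.
have [x0|x0] := eqVneq x 0.
  by rewrite x0 sub0r -mulN1r; apply: nonunitsMl => //; apply/overringN/overring1.
have [y0|y0] := eqVneq y 0; first by rewrite y0 subr0.
have [Vxy|Vyx] := overring_total (x / y).
  have -> : x - y = (x / y - 1) * y by field.
  by apply: nonunitsMl => //; exact: overringB Vxy overring1.
have -> : x - y = (1 - (x / y)^-1) * x by field; apply/andP.
by apply: nonunitsMl => //; exact: overringB overring1 Vyx.
Qed.

Lemma nonunitsD x y : nonunits V x -> nonunits V y -> nonunits V (x + y).
Proof.
move=> mx my; rewrite -[y]opprK; apply: nonunitsB => //.
by rewrite -sub0r; apply: nonunitsB => //; left.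
Qed.

Lemma not_nonunitV x : ~ nonunits V x -> V x^-1.
Proof. by move=> nmx; apply: contrapT => nVx; apply: nmx; right. Qed.

(** Valuation rings shrink as their maximal ideals grow. *)
Lemma sub_nonunits W : nonunits V `<=` nonunits W -> W `<=` V.
Proof.
move=> mVW x Wx; apply: contrapT => nVx.
have /mVW[/eqP|] : nonunits V x^-1 by right; rewrite invrK.
- by rewrite invr_eq0 => /eqP x0; apply: nVx; rewrite x0; exact: overring0.
- by rewrite invrK.
Qed.

End OneValuation.

Lemma nonunitsS V W : W `<=` V -> nonunits V `<=` nonunits W.
Proof. by move=> WV x [->|nVx]; [left|right=> /WV]. Qed.

(** * Construction of minimal valuation overrings *)

(** The maximal such [J] are the sets of nonunits of the minimal valuation
    overrings of [B]; keeping only [J] makes them accessible to Zorn's lemma. *)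
Definition proper_subrng B J : Prop :=
  [/\ J 0, (forall x y, J x -> J y -> J (x - y)),
      (forall x y, J x -> J y -> J (x * y)),
      (forall b x, B b -> J x -> J (b * x)) & ~ J 1].

Lemma nonunits_proper A B V : valuation_overring A V -> B `<=` V ->
  proper_subrng B (nonunits V).
Proof.
move=> valV BV; split; first by left.
- by move=> x y; exact: (nonunitsB valV).
- by move=> x y /(nonunits_sub valV); exact: (nonunitsMl valV).
- by move=> b x /BV; exact: (nonunitsMl valV).
- exact: (nonunits1 valV).
Qed.

Lemma ex_maximal_proper_subrng B J0 : proper_subrng B J0 ->
  exists J, [/\ proper_subrng B J, J0 `<=` J &
    forall J', proper_subrng B J' -> J `<=` J' -> J' `<=` J].
Proof.
move=> properJ0; pose P := [set X | proper_subrng B (X `|` J0)].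
have P0 : P set0 by rewrite /P /= set0U.
have [F FP totF|X [PX maxX]] := @Zorn_bigcup _ P; last first.
  exists (X `|` J0); split; [exact: PX|by move=> x J0x; right|].
  move=> J' properJ' XJ'; have [] := pselect (X `<` J').
    move/maxX => []; rewrite /P /= setUidl// => x J0x; apply: XJ'; by right.
  move=> nXJ' x J'x; apply: contrapT => nXx; apply: nXJ'; split.
    by move=> y Xy; apply: XJ'; left.
  by move=> J'X; apply: nXx; left; apply: J'X.
(* Adjoining the empty set to the chain lets two elements of the union always
   be found in a common member, even when the chain is empty. *)
pose F0 := F `|` [set set0].
have F0P X : F0 X -> P X by case=> [/FP|->].
have F0sub X : F0 X -> X `|` J0 `<=` \bigcup_(X in F) X `|` J0.
  by case=> [FX|->] x [Xx|J0x]; [left; exists X|right| |right].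
have F0cover x : (\bigcup_(X in F) X `|` J0) x ->
    exists2 X, F0 X & (X `|` J0) x.
  by case=> [[X FX Xx]|J0x]; [exists X; left|exists set0; right].
have F0cover2 x y : (\bigcup_(X in F) X `|` J0) x ->
    (\bigcup_(X in F) X `|` J0) y ->
    exists X, [/\ F0 X, (X `|` J0) x & (X `|` J0) y].
  move=> /F0cover[X FX Xx] /F0cover[Y FY Yy].
  have [XY|YX] : X `<=` Y \/ Y `<=` X.
    case: FX FY => [FX|->] [FY|->]; [exact: totF|by right|by left|by left].
  - by exists Y; split=> //; case: Xx => [/XY|]; [left|right].
  - by exists X; split=> //; case: Yy => [/YX|]; [left|right].
split.
- by right; case: properJ0.
- move=> x y Ux Uy; have [X [FX Xx Xy]] := F0cover2 x y Ux Uy.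
  by apply: (F0sub X FX); have [_ XB _ _ _] := F0P X FX; exact: XB.
- move=> x y Ux Uy; have [X [FX Xx Xy]] := F0cover2 x y Ux Uy.
  by apply: (F0sub X FX); have [_ _ XM _ _] := F0P X FX; exact: XM.
- move=> b x Bb /F0cover[X FX Xx].
  by apply: (F0sub X FX); have [_ _ _ XZ _] := F0P X FX; exact: XZ.
- by move=> /F0cover[X FX X1]; have [_ _ _ _] := F0P X FX; apply.
Qed.

(** The values at [x] of the polynomials of degree less than [n] with
    coefficients in [J]. *)
Definition poly_values J x n : set K :=
  [set z | exists p : {poly K},
     [/\ (size p <= n)%N, forall i, J p`_i & z = p.[x]]].

Section PolyValues.
Variables (B J : set K).
Hypothesis properJ : proper_subrng B J.

Let J0 : J 0. Proof. by case: properJ. Qed.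
Let JB x y : J x -> J y -> J (x - y).
Proof. by case: properJ => _ H _ _ _; exact: H. Qed.
Let JM x y : J x -> J y -> J (x * y).
Proof. by case: properJ => _ _ H _ _; exact: H. Qed.
Let JZ b x : B b -> J x -> J (b * x).
Proof. by case: properJ => _ _ _ H _; exact: H. Qed.
Let JD x y : J x -> J y -> J (x + y).
Proof.
move=> Jx Jy; rewrite -[y]opprK; apply: JB => //.
by rewrite -sub0r; exact: JB.
Qed.

Let J_sum (I : Type) (r : seq I) (P : pred I) (F : I -> K) :
  (forall i, P i -> J (F i)) -> J (\sum_(i <- r | P i) F i).
Proof. by move=> JF; apply: big_ind. Qed.

Lemma poly_values0 x n : poly_values J x n 0.
Proof. by exists 0; split; rewrite ?size_poly0 ?horner0// => i; rewrite coef0. Qed.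

Lemma poly_valuesB x n y z :
  poly_values J x n y -> poly_values J x n z -> poly_values J x n (y - z).
Proof.
move=> [p [szp Jp ->]] [q [szq Jq ->]]; exists (p - q); split.
- by rewrite (leq_trans (size_polyD _ _))// size_polyN geq_max szp.
- by move=> i; rewrite coefB; exact: JB.
- by rewrite hornerD hornerN.
Qed.

Lemma poly_valuesD x n y z :
  poly_values J x n y -> poly_values J x n z -> poly_values J x n (y + z).
Proof.
move=> Jy Jz; rewrite -[z]opprK; apply: poly_valuesB => //.
by rewrite -sub0r; apply: poly_valuesB => //; exact: poly_values0.
Qed.

Lemma poly_valuesZ x n c z :
  J c -> poly_values J x n z -> poly_values J x n (c * z).
Proof.
move=> Jc [p [szp Jp ->]]; exists (c *: p); split; rewrite ?hornerZ//.
  exact: leq_trans (size_scale_leq _ _) szp.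
by move=> i; rewrite coefZ; exact: JM.
Qed.

Lemma poly_values_monomial x n c i :
  J c -> (i < n)%N -> poly_values J x n (c * x ^+ i).
Proof.
move=> Jc ltin; exists (c *: 'X^i); split; last by rewrite hornerZ hornerXn.
  by rewrite (leq_trans (size_scale_leq _ _))// size_polyXn.
by move=> j; rewrite coefZ coefXn; case: eqP => _; rewrite ?mulr1 ?mulr0.
Qed.

Lemma poly_values_lead x n z : poly_values J x n.+1 z ->
  exists c z', [/\ J c, poly_values J x n z' & z = z' + c * x ^+ n].
Proof.
move=> [p [szp Jp ->]]; exists p`_n, (\poly_(i < n) p`_i).[x]; split=> //.
  exists (\poly_(i < n) p`_i); split=> [|i|//]; first exact: size_poly.
  by rewrite coef_poly; case: ifP.
by rewrite horner_poly (horner_coef_wide _ szp) big_ord_recr.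
Qed.

Lemma poly_values_const x n z : poly_values J x n.+1 z ->
  exists c z', [/\ J c, poly_values J x n z' & z = c + x * z'].
Proof.
move=> [p [szp Jp ->]]; exists p`_0, (\poly_(i < n) p`_i.+1).[x]; split=> //.
  exists (\poly_(i < n) p`_i.+1); split=> [|i|//]; first exact: size_poly.
  by rewrite coef_poly; case: ifP.
rewrite horner_poly (horner_coef_wide _ szp) big_ord_recl expr0 mulr1.
by congr (_ + _); rewrite mulr_sumr; apply: eq_bigr => i _; rewrite exprS mulrCA.
Qed.

Lemma poly_values_inv x m n c z : x != 0 -> J c -> (m <= n)%N ->
  poly_values J x^-1 m.+1 z -> poly_values J x n.+1 (c * x ^+ n * z).
Proof.
move=> x0 Jc lemn [q [szq Jq ->]].
rewrite (horner_coef_wide _ szq) mulr_sumr.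
apply: (big_ind (poly_values J x n.+1)); first exact: poly_values0.
  exact: poly_valuesD.
move=> i _; have lein : (i <= n)%N by rewrite (leq_trans _ lemn)// -ltnS.
have -> : c * x ^+ n * (q`_i * x^-1 ^+ i) = c * q`_i * x ^+ (n - i).
  by rewrite exprVn expfB_cond ?(negPf x0)//; ring.
by apply: poly_values_monomial; [exact: JM|rewrite ltnS leq_subr].
Qed.

Lemma poly_values_not1 x : poly_values J x 1 1 -> False.
Proof.
case: properJ => _ _ _ _ nJ1 [p [szp Jp]].
by rewrite (size1_polyC szp) hornerC => p1; apply: nJ1; rewrite p1.
Qed.

(** Chevalley's argument: in a pair of relations of least total degree, the
    shorter one removes the leading term of the longer one. *)
Lemma chevalley x n m : x != 0 ->
  poly_values J x n.+1 1 -> poly_values J x^-1 m.+1 1 -> False.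
Proof.
have [N] := ubnP (n + m)%N; elim: N x n m => // N IH x n m ltnmN x0 Jxn Jxm.
wlog lemn : x n m ltnmN x0 Jxn Jxm / (m <= n)%N.
  move=> wlg; have [|/ltnW lenm] := leqP m n; first exact: wlg Jxn Jxm.
  by apply: (wlg x^-1 m n); rewrite ?invr_eq0 ?invrK 1?addnC.
case: m => [|m] in ltnmN Jxm lemn; first exact: poly_values_not1 Jxm.
case: n => [//|n] in ltnmN Jxn lemn.
have [a [z [Ja Jz E1]]] := poly_values_lead Jxn.
have [q0 [w [Jq0 Jw E2]]] := poly_values_const Jxm.
apply: (IH x n m.+1 _ x0 _ Jxm); first by rewrite -ltnS.
have -> : 1 = q0 + (z - q0 * z) + a * x ^+ n * w.
  have -> : a * x ^+ n * w = a * x ^+ n.+1 * (1 - q0).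
    by rewrite {1}E2 exprSr; field.
  have -> : z = 1 - a * x ^+ n.+1 by rewrite E1 addrK.
  ring.
apply: poly_valuesD; last exact: poly_values_inv Jw.
apply: poly_valuesD; last by apply: poly_valuesB => //; exact: poly_valuesZ.
by rewrite -[q0]mulr1 -(expr0 x); exact: poly_values_monomial.
Qed.

Definition multiplier J : set K := [set x | forall j, J j -> J (x * j)].

Hypothesis maxJ : forall J', proper_subrng B J' -> J `<=` J' -> J' `<=` J.

(** [J[x]] is a subrng stable under [B] and contains [J]; if it is proper it
    equals [J]. *)
Lemma maximal_multiplier x :
  (forall n, ~ poly_values J x n.+1 1) -> multiplier J x.
Proof.
move=> nJ1 j Jj; have mono n : poly_values J x n `<=` poly_values J x n.+1.
  by move=> z [p [szp Jp ->]]; exists p; split=> //; exact: ltnW.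
apply: (maxJ (J' := \bigcup_n poly_values J x n)).
- split.
  + by exists 0%N => //; exact: poly_values0.
  + move=> y z [n _ [p [szp Jp ->]]] [m _ [q [szq Jq ->]]].
    exists (maxn n m) => //; apply: poly_valuesB.
      by exists p; split; rewrite // leq_max szp.
    by exists q; split; rewrite // leq_max szq orbT.
  + move=> y z [n _ [p [szp Jp ->]]] [m _ [q [szq Jq ->]]].
    exists (size (p * q)) => //; exists (p * q); split; rewrite ?hornerM//.
    by move=> i; rewrite coefM; apply: J_sum => k _; exact: JM.
  + move=> b _ Bb [n _ [p [szp Jp ->]]]; exists n => //.
    exists (b *: p); split; rewrite ?hornerZ//.
      exact: leq_trans (size_scale_leq _ _) szp.
    by move=> i; rewrite coefZ; exact: JZ.
  + by move=> [n _ /mono]; exact: nJ1.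
- move=> c Jc; exists 1%N => //; rewrite -[c]mulr1 -(expr0 x).
  exact: poly_values_monomial.
exists 2%N => //; rewrite mulrC -[x]expr1; exact: poly_values_monomial.
Qed.

Lemma maximal_multiplier_minimal :
  minimal_overring B (multiplier J) /\ J `<=` nonunits (multiplier J).
Proof.
have mJ : J `<=` nonunits (multiplier J).
  move=> j Jj; have [->|j0] := eqVneq j 0; first by left.
  right=> /(_ j Jj); rewrite mulVf//; by case: properJ.
have valJ : valuation_overring B (multiplier J).
  apply/valuation_overringP; split.
  - by move=> b Bb j; exact: JZ.
  - by move=> j; rewrite mul1r.
  - by move=> x y Mx My j Jj; rewrite mulrBl; apply: JB; [exact: Mx|exact: My].
  - by move=> x y Mx My j Jj; rewrite -mulrA; apply/Mx/My.
  - move=> x; have [->|x0] := eqVneq x 0; first by left=> j _; rewrite mul0r.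
    apply: contrapT => /not_orP[nMx nMVx].
    have [n Jn] : exists n, poly_values J x n.+1 1.
      by apply: contrapT => /forallNP; move/maximal_multiplier.
    have [m Jm] : exists n, poly_values J x^-1 n.+1 1.
      by apply: contrapT => /forallNP; move/maximal_multiplier.
    exact: chevalley Jn Jm.
split=> //; split=> // W valW WV.
have mVW := nonunitsS WV.
apply/seteqP; split=> //; apply: (sub_nonunits valW).
apply: (subset_trans _ mJ); apply: maxJ; last exact: (subset_trans mJ mVW).
by apply: (nonunits_proper valW); case/valuation_overringP: valW.
Qed.

End PolyValues.

(** Enlarging [J0] to a maximal [J] achieves two things at once: [J0] consists
    of nonunits, and the valuation ring is minimal. *)
Lemma ex_minimal_overring B J0 : proper_subrng B J0 ->
  exists2 V, minimal_overring B V & J0 `<=` nonunits V.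
Proof.
move=> /ex_maximal_proper_subrng[J [properJ J0J maxJ]].
have [minV JV] := maximal_multiplier_minimal properJ maxJ.
by exists (multiplier J) => //; exact: (subset_trans _ JV).
Qed.

(** If [m_V + I] is proper then it consists of nonunits of a minimal valuation
    overring, which is contained in [V], hence equal to [V]. *)
Lemma minimal_absorbs B V I : minimal_overring B V -> I `<=` V ->
    proper_subrng B I -> (forall i, I i -> ~ nonunits V (1 - i)) ->
  I `<=` nonunits V.
Proof.
move=> [valV minV] IV [I0 IB IM IZ _] nI1.
have BV : B `<=` V by case/valuation_overringP: valV.
pose J0 : set K := [set x | exists2 m, nonunits V m & I (x - m)].
have properJ0 : proper_subrng B J0.
  split.
  - by exists 0; [left|rewrite subr0].
  - move=> x y [m mm Im] [n mn In]; exists (m - n).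
      exact: (nonunitsB valV).
    have -> : x - y - (m - n) = (x - m) - (y - n) by ring.
    exact: IB.
  - move=> x y [m mm Im] [n mn In].
    exists (m * n + (x - m) * n + (y - n) * m).
      do 2?[apply: (nonunitsD valV)]; apply: (nonunitsMl valV) => //.
      + exact: nonunits_sub valV _ mm.
      + exact: IV.
      + exact: IV.
    have -> : x * y - (m * n + (x - m) * n + (y - n) * m) = (x - m) * (y - n).
      by ring.
    exact: IM.
  - move=> b x Bb [m mm Im]; exists (b * m).
      by apply: (nonunitsMl valV) => //; exact: BV.
    by rewrite -mulrBr; exact: IZ.
  - by move=> [m mm Im]; apply: nI1 Im _; rewrite subKr.
have [W [valW _] J0W] := ex_minimal_overring properJ0.
have mVJ0 : nonunits V `<=` J0 by move=> m mm; exists m; rewrite ?subrr.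
have <- : W = V.
  by apply: minV => //; apply: (sub_nonunits valV); exact: (subset_trans _ J0W).
apply: (subset_trans _ J0W) => i Ii; exists 0; [by left|by rewrite subr0].
Qed.

End Valuation.

(** * Centers of valuation overrings *)

Section Domain.
Variable D : idomainType.
Local Notation K := {fraction D}.
Local Notation "a %:F" := (@tofrac D a).
Local Notation R := (base_ring D).
Implicit Types (I : set D) (P Q M : Spec D) (V W : set K).

Lemma idealP I : idealr_closed (mem I) ->
  [/\ I 0, ~ I 1, (forall a b, I a -> I b -> I (a - b)) &
      forall c a, I a -> I (c * a)].
Proof.
move=> [I0 nI1 IL]; have IZ c a : I a -> I (c * a).
  by move=> /mem_set Ia; rewrite -[c * a]addr0; apply: set_mem; exact: IL.
split=> //; first exact: set_mem.
  by move=> /mem_set; exact/negP.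
move=> a b Ia Ib; rewrite addrC -mulN1r.
by apply: set_mem; apply: IL; exact: mem_set.
Qed.

Lemma ideal_addl I a b : idealr_closed (mem I) -> I (a - b) -> I b -> I a.
Proof.
move=> [_ _ IL] /mem_set Iab /mem_set Ib; apply: set_mem.
by rewrite -(subrK b a) -[a - b]mul1r; exact: IL.
Qed.

Section SpecFacts.
Variable P : Spec D.

Lemma spec0 : (P : set D) 0. Proof. by have [] := idealP (spec_ideal P). Qed.

Lemma spec1 : ~ (P : set D) 1. Proof. by have [] := idealP (spec_ideal P). Qed.

Lemma specB a b : (P : set D) a -> (P : set D) b -> (P : set D) (a - b).
Proof. by have [_ _ PB _] := idealP (spec_ideal P); exact: PB. Qed.

Lemma specMl c a : (P : set D) a -> (P : set D) (c * a).
Proof. by have [_ _ _ PZ] := idealP (spec_ideal P); exact: PZ. Qed.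

Lemma specM a b : (P : set D) (a * b) -> (P : set D) a \/ (P : set D) b.
Proof.
by move=> /mem_set Pab; have /orP[/set_mem|/set_mem] := @spec_prime _ P a b Pab;
  [left|right].
Qed.

Lemma spec_expM m s n :
  (P : set D) (m ^+ n * s) -> (P : set D) m \/ (P : set D) s.
Proof.
elim: n => [|n IH]; first by rewrite expr0 mul1r; right.
by rewrite exprS -mulrA => /specM[|/IH]; [left|].
Qed.

Lemma spec_compl_neq0 s : ~ (P : set D) s -> s%:F != 0.
Proof.
move=> nPs; rewrite tofrac_eq0; apply/eqP => s0.
by apply: nPs; rewrite s0; exact: spec0.
Qed.

Lemma base_ring_sub_localization : R `<=` localization P.
Proof.
move=> _ [a _ <-]; exists a, 1; rewrite tofrac1 divr1; split=> //.
exact: spec1.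
Qed.

Lemma localizationMl a x : localization P x -> localization P (a%:F * x).
Proof.
move=> [b [s [nPs ->]]]; exists (a * b), s; split=> //.
by rewrite tofracM mulrA.
Qed.

Lemma localization_denom x s : ~ (P : set D) s -> localization P (s%:F * x) ->
  localization P x.
Proof.
move=> nPs [b [t [nPt E]]]; exists b, (s * t); split; first by move=> /specM[].
have s0 := spec_compl_neq0 nPs; have t0 := spec_compl_neq0 nPt.
by rewrite tofracM invfM mulrCA -E mulrA mulVf// mul1r.
Qed.

Definition localized_ideal : set K :=
  [set x | exists a s, [/\ (P : set D) a, ~ (P : set D) s & x = a%:F / s%:F]].

Lemma localized_ideal_proper : proper_subrng (localization P) localized_ideal.
Proof.
split.
- by exists 0, 1; split; [exact: spec0|exact: spec1|rewrite tofrac0 mul0r].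
- move=> _ _ [a [s [Pa nPs ->]]] [b [t [Pb nPt ->]]].
  have s0 := spec_compl_neq0 nPs; have t0 := spec_compl_neq0 nPt.
  exists (t * a - s * b), (s * t); split.
  + by apply: specB; exact: specMl.
  + by move=> /specM[].
  + by rewrite tofracB !tofracM -mulNr addf_div// mulNr (mulrC a%:F) (mulrC b%:F).
- move=> _ _ [a [s [Pa nPs ->]]] [b [t [Pb nPt ->]]].
  exists (a * b), (s * t); split; first exact: specMl.
  + by move=> /specM[].
  + by rewrite !tofracM invfM mulrACA.
- move=> _ _ [a [s [nPs ->]]] [b [t [Pb nPt ->]]].
  exists (a * b), (s * t); split; first exact: specMl.
  + by move=> /specM[].
  + by rewrite !tofracM invfM mulrACA.
- move=> [a [s [Pa nPs E]]]; apply: (nPs); suff -> : s = a by [].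
  apply/eqP; rewrite -tofrac_eq; apply/eqP.
  by rewrite -[LHS]mul1r E mulfVK// (spec_compl_neq0 nPs).
Qed.

Lemma sub_localized_ideal a : (P : set D) a -> localized_ideal a%:F.
Proof.
by move=> Pa; exists a, 1; rewrite tofrac1 divr1; split=> //; exact: spec1.
Qed.

End SpecFacts.

Lemma localizationS P Q : (Q : set D) `<=` P ->
  localization P `<=` localization Q.
Proof. by move=> QP _ [a [s [nPs ->]]]; exists a, s; split=> // /QP. Qed.

Lemma image_ideal_proper I : idealr_closed (mem I) ->
  proper_subrng R (@tofrac D @` I).
Proof.
move=> /idealP[I0 nI1 IB IZ]; split.
- by exists 0; rewrite ?tofrac0.
- by move=> _ _ [a Ia <-] [b Ib <-]; exists (a - b); [exact: IB|rewrite tofracB].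
- by move=> _ _ [a Ia <-] [b Ib <-]; exists (a * b); [exact: IZ|rewrite tofracM].
- by move=> _ _ [a _ <-] [b Ib <-]; exists (a * b); [exact: IZ|rewrite tofracM].
- by move=> [a Ia] /eqP; rewrite -tofrac1 tofrac_eq => /eqP a1; rewrite a1 in Ia.
Qed.

Definition center_set V : set D := [set a | nonunits V a%:F].

Section Center.
Variable V : set K.
Hypothesis valV : valuation_overring R V.

Lemma val_tofrac a : V a%:F.
Proof. by case/valuation_overringP: valV => RV _ _ _ _; apply: RV; exists a. Qed.

Lemma center_ideal : idealr_closed (mem (center_set V)).
Proof.
split.
- by apply: mem_set; left; rewrite tofrac0.
- by apply/negP => /set_mem; rewrite /center_set /= tofrac1; exact: nonunits1 valV.
- move=> a u v /set_mem mu /set_mem mv; apply: mem_set.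
  rewrite /center_set /= tofracD tofracM; apply: (nonunitsD valV) => //.
  by apply: (nonunitsMl valV) => //; exact: val_tofrac.
Qed.

Lemma center_prime : prime_idealr_closed (mem (center_set V)).
Proof.
move=> u v /set_mem muv; apply/orP.
have [mu|nmu] := pselect (center_set V u).
  by left; exact: mem_set.
have Vu := not_nonunitV nmu.
right; apply: mem_set; case: muv => [/eqP|nVuv].
  rewrite tofrac_eq0 mulf_eq0 => /orP[/eqP u0|/eqP v0].
    by case: nmu; left; rewrite u0 tofrac0.
  by left; rewrite v0 tofrac0.
right=> Vv; apply: nVuv; rewrite tofracM invfM. exact: (overringM valV Vu Vv).
Qed.

Definition center : Spec D := MkSpec center_ideal center_prime.

Lemma localization_sub_val Q :
  center_set V `<=` Q -> localization Q `<=` V.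
Proof.
move=> cQ _ [a [s [nQs ->]]]; apply: (overringM valV); first exact: val_tofrac.
by apply: not_nonunitV => /cQ.
Qed.

Lemma center_sub Q : localization Q `<=` V -> center_set V `<=` Q.
Proof.
move=> QV a ma; apply: contrapT => nQa; case: ma => [/eqP|].
  by apply/negP; exact: spec_compl_neq0 nQa.
by apply; apply: QV; exists 1, a; rewrite tofrac1 mul1r.
Qed.

Lemma localization_centerV x :
  V x -> localization center x^-1 -> localization center x.
Proof.
move=> Vx [a [s [nms E]]].
have s0 := spec_compl_neq0 nms.
have [x0|x0] := eqVneq x 0.
  by rewrite x0; exists 0, s; rewrite tofrac0 mul0r.
have sE : s%:F = x * a%:F.
  by apply: (mulIf (invr_neq0 x0)); rewrite {1}E mulrC mulfVK // mulrAC divff// mul1r.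
exists s, a; split.
  by move=> ma; apply: nms; rewrite /= /center_set /= sE; exact: (nonunitsMl valV).
by rewrite -[LHS]invrK E invf_div.
Qed.

End Center.

Lemma valuation_overring_localizationP P V :
  valuation_overring (localization P) V <->
  valuation_overring R V /\ localization P `<=` V.
Proof.
split=> [/valuation_overringP[PV V1 VB VM Vt]|
         [/valuation_overringP[_ V1 VB VM Vt] PV]].
  split=> //; apply/valuation_overringP; split=> //.
  exact: subset_trans (@base_ring_sub_localization P) PV.
by apply/valuation_overringP.
Qed.

(** Working over [D_P] instead of [D] prevents the center from growing beyond
    [P]. *)
Lemma ex_centered P :
  exists2 V, valuation_overring R V & center_set V = P.
Proof.
have [V [valV _] PV] := ex_minimal_overring (localized_ideal_proper P).
have [valRV locV] := (valuation_overring_localizationP P V).1 valV.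
exists V => //; apply/seteqP; split; first exact: center_sub.
by move=> a Pa; apply: PV; exact: sub_localized_ideal.
Qed.

Lemma ex_minimal_above P :
  exists2 V, minimal_overring R V & P `<=` center_set V.
Proof.
have [V minV PV] := ex_minimal_overring (image_ideal_proper (spec_ideal P)).
by exists V => // a Pa; apply: PV; exists a.
Qed.

(** A proper ideal containing the center of [V] consists of nonunits of [V] by
    [minimal_absorbs]. *)
Lemma Max_center V (valV : valuation_overring R V) :
  minimal_overring R V -> Max D (center valV).
Proof.
move=> minV I idI cI; apply/seteqP; split=> // a Ia.
have [_ nI1 _ _] := idealP idI.
have IV : (@tofrac D @` I) `<=` nonunits V.
  apply: (minimal_absorbs minV).
  - by move=> _ [b _ <-]; exact: val_tofrac.
  - exact: image_ideal_proper.
  - move=> _ [b Ib <-]; rewrite -tofrac1 -tofracB => m1b.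
    have Iu : I (1 - b) by exact: cI.
    exact/nI1/(ideal_addl idI Iu).
by apply: IV; exists a.
Qed.

Lemma Max_above P : exists2 M, Max D M & P `<=` M.
Proof.
have [V minV PV] := ex_minimal_above P.
by exists (center minV.1) => //; exact: Max_center.
Qed.

Lemma ex_minimal_centered M : Max D M ->
  exists2 V, minimal_overring R V & center_set V = M.
Proof.
move=> maxM; have [V minV MV] := ex_minimal_above M.
by exists V => //; apply: maxM => //; exact: center_ideal minV.1.
Qed.

(** [M D_M] consists of nonunits of [V] by [minimal_absorbs], because [1 - x] is
    a unit of [D_M] for every [x] in [M D_M]. *)
Lemma minimal_localization_center M V :
  minimal_overring (localization M) V -> center_set V = M.
Proof.
move=> minV; have [valV locV] := (valuation_overring_localizationP M V).1 minV.1.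
apply/seteqP; split; first exact: center_sub.
move=> a Ma.
suff : localized_ideal M `<=` nonunits V by apply; exact: sub_localized_ideal.
apply: (minimal_absorbs minV); last 1 first.
- move=> _ [b [s [Mb nMs ->]]]; have s0 := spec_compl_neq0 nMs.
  have nMsb : ~ (M : set D) (s - b).
    by move=> /(ideal_addl (spec_ideal M))/(_ Mb).
  have sb0 := spec_compl_neq0 nMsb.
  have -> : 1 - b%:F / s%:F = (s - b)%:F / s%:F.
    by rewrite tofracB mulrBl mulfV.
  case=> [/eqP|]; first by rewrite mulf_eq0 invr_eq0 (negPf sb0) (negPf s0).
  by apply; apply: locV; rewrite invf_div; exists s, (s - b).
- move=> _ [b [s [Mb nMs ->]]]; apply: locV; by exists b, s.
- exact: localized_ideal_proper.
Qed.

(** Minimality over [D_M] passes to [D]: a valuation overring [W] of [D] inside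
    [V] has a center containing that of [V], which is [M], so by maximality its
    center is [M] and it contains [D_M]. *)
Lemma minimal_localizationP M V : Max D M ->
  minimal_overring (localization M) V <->
  minimal_overring R V /\ localization M `<=` V.
Proof.
move=> maxM; split=> [minV|[[valV minV] locV]]; last first.
  split=> [|W /valuation_overring_localizationP[valW _]]; last exact: minV.
  by apply/valuation_overring_localizationP.
have [valV locV] := (valuation_overring_localizationP M V).1 minV.1.
split=> //; split=> // W valW WV; apply: minV.2 => //.
apply/valuation_overring_localizationP; split=> //.
apply: localization_sub_val => //.
have -> // : center_set W = M.
apply: maxM; first exact: center_ideal valW.
by rewrite -(minimal_localization_center minV) => a; exact: nonunitsS.
Qed.

(** * Relations with a coefficient outside the prime ideal *)

(** With [a] the coefficient of degree [n.+1], multiplying the relation by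
    [a ^+ n] turns it into an integral equation for [a * y]. *)
Lemma integral_lead_mul (p : {poly D}) n (y : K) :
  (size p <= n.+2)%N -> (map_poly (@tofrac D) p).[y] = 0 ->
  integralOver (@tofrac D) ((p`_n.+1)%:F * y).
Proof.
move=> szp py0; set a := p`_n.+1.
pose c i := if i == n.+1 then 1 else p`_i * a ^+ (n - i).
have map_wide (q : {poly D}) z : (size q <= n.+2)%N ->
    (map_poly (@tofrac D) q).[z] = \sum_(i < n.+2) (q`_i)%:F * z ^+ i.
  move=> szq; rewrite (horner_coef_wide _ (leq_trans (size_poly _ _) szq)).
  by apply: eq_bigr => i _; rewrite coef_map.
exists (\poly_(i < n.+2) c i).
  by rewrite monicE lead_coef_poly /c ?eqxx ?oner_eq0.
rewrite /root map_wide ?size_poly//; apply/eqP.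
transitivity (a%:F ^+ n * (map_poly (@tofrac D) p).[y]); last first.
  by rewrite py0 mulr0.
rewrite map_wide// mulr_sumr.
apply: eq_bigr => i _; rewrite coef_poly ltn_ord /c exprMn.
case: eqP => [->|/eqP ni].
  by rewrite tofrac1 mul1r exprSr -mulrA.
have lein : (i <= n)%N by move: (ltn_ord i); rewrite ltnS leq_eqVlt (negPf ni).
have -> : a%:F ^+ n = a%:F ^+ (n - i) * a%:F ^+ i by rewrite -exprD subnK.
by rewrite tofracM tofracXn -!mulrA mulrCA; congr (_ * _); rewrite mulrCA.
Qed.

(** Seidenberg's lemma: over an integrally closed local domain, a relation with
    a unit coefficient forces [y] or [y^-1] into the domain. If the leading
    coefficient [a] is not a unit then neither is [a * y], which lies in the
    domain, and it can be absorbed into the next coefficient. *)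
Lemma seidenberg M (p : {poly D}) (y : K) :
    integrally_closed D -> (map_poly (@tofrac D) p).[y] = 0 ->
    (exists i, ~ (M : set D) p`_i) ->
  localization M y \/ localization M y^-1.
Proof.
move=> icD.
have [n] := ubnP (size p); elim: n p => // n IH p; rewrite ltnS => szp py0 [i nMi].
have ltin : (i < n)%N.
  rewrite (leq_trans _ szp)// ltnNge; apply/negP => /(nth_default 0) pi0.
  by apply: nMi; rewrite pi0; exact: spec0.
case: n => [//|[|n]] in IH szp ltin *.
  case: i nMi ltin => // nMp0 _; case: nMp0.
  move: py0; rewrite (size1_polyC szp) map_polyC hornerC coefC/= => /eqP.
  by rewrite tofrac_eq0 => /eqP ->; exact: spec0.
have [b _ bE] := icD _ (integral_lead_mul szp py0).
have [Ma|nMa] := pselect ((M : set D) p`_n.+1); last first.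
  left; apply: (localization_denom nMa); rewrite -bE.
  exact/base_ring_sub_localization/imageT.
have [Mb|nMb] := pselect ((M : set D) b); last first.
  right; exists p`_n.+1, b; split=> //.
  have b0 := spec_compl_neq0 nMb.
  have : (p`_n.+1)%:F * y != 0 by rewrite -bE.
  by rewrite mulf_eq0 negb_or bE => /andP[a0 y0]; rewrite invfM mulrA divff// mul1r.
pose q := p - (p`_n.+1) *: 'X^(n.+1) + b *: 'X^n.
have qE j : q`_j = p`_j - p`_n.+1 * (j == n.+1)%:R + b * (j == n)%:R.
  by rewrite /q coefD coefB !coefZ !coefXn.
apply: (IH q).
- rewrite ltnS; apply/leq_sizeP => j; rewrite leq_eqVlt qE => /orP[/eqP <-|ltnj].
    by rewrite eqxx mulr1 subrr add0r gtn_eqF// mulr0.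
  rewrite !gtn_eqF ?(ltnW ltnj)// !mulr0 subr0 addr0.
  by apply: nth_default; exact: leq_trans szp ltnj.
- have -> : (map_poly (@tofrac D) q).[y] = (map_poly (@tofrac D) p).[y] -
      (p`_n.+1)%:F * y ^+ n.+1 + b%:F * y ^+ n.
    rewrite rmorphD rmorphB /= !map_polyZ !map_polyXn.
    by rewrite hornerD hornerD hornerN !hornerZ !hornerXn.
  by rewrite py0 bE sub0r exprS mulrA addNr.
exists i => Mqi; apply: nMi.
apply: (@ideal_addl _ _ (p`_n.+1 * (i == n.+1)%:R - b * (i == n)%:R)
  (spec_ideal M)).
  by rewrite opprB addrA addrAC -qE.
by apply: specB; rewrite mulrC; exact: specMl.
Qed.

(** * Localizations with a Noetherian space of minimal valuation overrings *)

(** The ideal generated by [M] and [y - 1] in [D[y]] is proper by Seidenberg's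
    lemma: it is [{f(y) | f(1) in M}], and if [f(y) = 1] then [f - 1] is a
    relation whose value at 1 lies outside [M]. Asking for residue 1 rather than
    for a unit is what a passage to smaller valuation rings preserves. *)
Lemma ex_minimal_residue1 M (y : K) : integrally_closed D ->
    ~ localization M y -> ~ localization M y^-1 ->
  exists V, [/\ minimal_overring R V, M `<=` center_set V &
                nonunits V (y - 1)].
Proof.
move=> icD nMy nMVy.
pose J0 : set K :=
  [set z | exists2 f : {poly D}, (M : set D) f.[1] &
                                 (map_poly (@tofrac D) f).[y] = z].
have properJ0 : proper_subrng R J0.
  split.
  - by exists 0; rewrite ?rmorph0 ?horner0//; exact: spec0.
  - move=> _ _ [f Mf <-] [g Mg <-]; exists (f - g).
      by rewrite hornerD hornerN; exact: specB.
    by rewrite rmorphB hornerD hornerN.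
  - move=> _ _ [f Mf <-] [g Mg <-]; exists (f * g).
      by rewrite hornerM; exact: specMl.
    by rewrite rmorphM hornerM.
  - move=> _ _ [c _ <-] [f Mf <-]; exists (c%:P * f).
      by rewrite hornerM; exact: specMl.
    by rewrite rmorphM /= map_polyC hornerM hornerC.
  - move=> [f Mf fy1].
    have [||//|//] := @seidenberg M (f - 1) y icD.
      by rewrite rmorphB rmorph1 hornerD hornerN fy1 hornerC subrr.
    apply: contrapT => /forallNP Mcoef.
    have : (M : set D) (f - 1).[1].
      rewrite horner_coef; apply: (big_ind (M : set D)).
      + exact: spec0.
      + move=> a b Ma Mb; apply: (ideal_addl (spec_ideal M) _ Mb).
        by rewrite addrK.
      + move=> i _; rewrite mulrC; apply: specMl.
        by apply: contrapT; exact: Mcoef.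
    rewrite hornerD hornerN hornerC => Mf1; apply: (@spec1 M).
    by rewrite -[1](subKr f.[1]); exact: specB.
have [V minV J0V] := ex_minimal_overring properJ0; exists V; split=> //.
  by move=> a Ma; apply: J0V; exists a%:P; rewrite ?map_polyC ?hornerC.
apply: J0V; exists ('X - 1); first by rewrite !hornerE subrr; exact: spec0.
by rewrite rmorphB rmorph1 /= map_polyX !hornerE.
Qed.

(** If no [m ^+ n * x] lies in [D_M], then some minimal [V n] over [D_M] has
    [m ^+ n * x] congruent to 1 and [m] a nonunit, so that [V n] contains
    [m ^+ n * x] but not [m ^+ k * x] for [k < n]. Hence no [V k] is a limit of
    the sequence along a non-principal ultrafilter. *)
Lemma noetherian_Zar_min_local M (x : K) (m : D) :
    integrally_closed D -> Max D M ->
    noetherian_family (minimal_overring (localization M)) ->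
    (M : set D) m -> ~ localization M x -> ~ localization M x^-1 ->
  exists n, localization M (m%:F ^+ n * x).
Proof.
move=> icD maxM noethM Mm nMx nMVx; apply: contrapT => /forallNP nMmx.
pose y n := m%:F ^+ n * x.
have m0 : m%:F != 0.
  apply/eqP => m0; apply: (nMmx 1%N); rewrite m0 mul0r -tofrac0.
  exact/base_ring_sub_localization/imageT.
have /choice[V VP] n : exists V, [/\ minimal_overring (localization M) V,
    nonunits V m%:F & nonunits V (y n - 1)].
  have [||V [minV MV yV]] := @ex_minimal_residue1 M (y n) icD.
  - exact: nMmx.
  - move=> MVy; apply: nMVx.
    have -> : x^-1 = (m ^+ n)%:F * (y n)^-1.
      by rewrite invfM tofracXn mulrA divff ?mul1r// expf_neq0.
    exact: localizationMl.
  exists V; split=> //; last exact: MV.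
  apply/minimal_localizationP => //; split=> //.
  apply: (localization_sub_val minV.1).
  have -> // : center_set V = M.
  by apply: maxM => //; exact: center_ideal minV.1.
have [U [UU ooU]] := ultraFilterLemma (_ : ProperFilter \oo).
have minV n : minimal_overring (localization M) (V n) by have [] := VP n.
have /filter_ex[k Vk] := noethM V U minV UU.
have Vyk : V k (y k).
  have [[valV _] _ myk] := VP k; rewrite -(subrK 1 (y k)).
  apply: (overringD valV); first exact: nonunits_sub valV _ myk.
  exact: overring1 valV.
have Ugt : U [set n | (k < n)%N] by apply: ooU; exists k.+1.
have [n [/= Vnyk ltkn]] := filter_ex (filterI (Vk _ Vyk) Ugt).
have [[valV _] mm myn] := VP n; apply: (nonunits1 valV).
have mynk : nonunits (V n) (y n).
  have -> : y n = m%:F ^+ (n - k).-1 * y k * m%:F.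
    rewrite /y -[in LHS](subnK ltkn) addnS -addSn exprD exprSr subnS.
    by rewrite -!mulrA; congr (_ * _); rewrite mulrC mulrA.
  apply: (nonunitsMl valV) => //; apply: (overringM valV) => //.
  elim: (_.-1) => [|j IH]; first exact: overring1 valV.
  by rewrite exprS; apply: (overringM valV) => //; exact: nonunits_sub valV _ mm.
by rewrite -[1](subKr (y n)); exact: (nonunitsB valV).
Qed.

(** * From the localizations to the domain *)

(** Taking centers is continuous: [a] is outside the center of [V] if and only if
    [V] contains the inverse of [a]. *)
Lemma noetherian_primes_centers (F : set (set K)) (X : set (Spec D)) :
    noetherian_family F ->
    (forall P, X P -> exists V, [/\ valuation_overring R V, F V &
                                    center_set V = P]) ->
  noetherian_primes X.
Proof.
move=> noethF XF P U XP UU.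
have /choice[V VP] n : exists V, [/\ valuation_overring R V, F V &
    center_set V = P n] by exact: XF.
have FV n : F (V n) by have [] := VP n.
apply: filterS (noethF V U FV UU) => k Vk a Ua; apply: contrapT => nPa.
have [valV _ cV] := VP k; have a0 := spec_compl_neq0 nPa.
have /Vk UVa : V k a%:F^-1 by apply: not_nonunitV; rewrite -cV in nPa.
apply: (@filter_not_empty _ U); apply: filterS (filterI Ua UVa) => n [/= Pna Vna].
have [_ _ cVn] := VP n; move: Pna; rewrite -cVn => -[/eqP|//].
by apply/negP.
Qed.

(** The limit prime [Q] of the centers is the center of the limit ring. When the
    centers are almost all equal to [Q], the sequence lives over one localization;
    when they properly contain [Q], the local result puts [V k] inside [D_Q],
    hence inside the limit ring. *)
Lemma noetherian_glue (F : set (set K)) (X : set (Spec D))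
    (valF : forall V, F V -> valuation_overring R V) :
    integrally_closed D -> noetherian_primes X ->
    (forall V (FV : F V), X (center (valF V FV))) ->
    (forall M, Max D M ->
       noetherian_family (minimal_overring (localization M))) ->
    (forall M, Max D M ->
       noetherian_family [set V | F V /\ localization M `<=` V]) ->
  noetherian_family F.
Proof.
move=> icD noethX XF noethmin noethF V U FV UU.
pose P n := center (valF _ (FV n)).
pose E := [set k | forall a, U [set n | (P n : set D) a] -> (P k : set D) a].
have UE : U E by apply: noethX => // n; exact: XF.
pose Q := [set a | U [set n | (P n : set D) a]].
have [UQ|UnQ] := in_ultra_setVsetC [set k | (P k : set D) `<=` Q] UU.
  have [k0 [Ek0 PkQ]] := filter_ex (filterI UE UQ).
  have [M maxM PM] := Max_above (P k0).
  pose G := [set n | (P n : set D) `<=` P k0].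
  have UG : U G.
    by apply: filterS UQ => n PnQ a /PnQ; exact: Ek0.
  (* Replacing the exceptional terms by [V k0] keeps the limit along [U] and puts
     the whole sequence over [D_M]. *)
  pose W n := if `[< G n >] then V n else V k0.
  have WP n : F (W n) /\ localization M `<=` W n.
    rewrite /W; case: asboolP => [Gn|_]; split=> //;
      apply: (localization_sub_val (valF _ (FV _))) => a /=.
      by move=> /Gn; exact: PM.
    exact: PM.
  have WE n : G n -> W n = V n by rewrite /W; case: asboolP.
  have UGW : U (G `&` [set k | W k `<=` pointwise_limit W U]).
    by apply: filterI => //; exact: noethF maxM W U WP UU.
  apply: filterS UGW => k [/= Gk]; rewrite (WE k Gk) => Wk x /Wk UW.
  by apply: filterS (filterI UG UW) => n [/= /WE <-].
apply: filterS (filterI UE UnQ) => k [Ek nPkQ] x Vkx.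
have QPk : Q `<=` P k by move=> a Qa; exact: Ek.
have [m /not_implyP[Pkm nQm]] : exists m, ~ ((P k : set D) m -> Q m).
  by apply/existsNP => PkQ; apply: nPkQ => a; exact: PkQ.
have [M maxM PM] := Max_above (P k).
have [a [s [nQs xE]]] : exists a s, ~ Q s /\ x = a%:F / s%:F.
  apply: contrapT => nx.
  have nPkx : ~ localization (P k) x.
    by move=> [a [s [nPs xE]]]; apply: nx; exists a, s; split=> // /QPk.
  have nMx : ~ localization M x by move=> /(localizationS PM).
  have nMVx : ~ localization M x^-1.
    move=> /(localizationS PM); move: nPkx; apply: contra_not.
    exact: localization_centerV.
  have [n [a [s [nMs mxE]]]] := noetherian_Zar_min_local icD maxM (noethmin M maxM)
    (PM _ Pkm) nMx nMVx.
  have nQs : ~ Q s by move=> /QPk/PM.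
  have nQms : ~ Q (m ^+ n * s).
    apply/(ultraNP _ UU).
    apply: filterS (filterI ((ultraNP _ UU).2 nQm) ((ultraNP _ UU).2 nQs)) => j.
    by move=> [nPm nPs] /spec_expM[].
  have m0 : m%:F != 0.
    rewrite tofrac_eq0; apply/eqP => m0; apply: nQm; rewrite m0 /Q /=.
    by apply: filterE => j; exact: (spec0 (P j)).
  apply: nx; exists a, (m ^+ n * s); split=> //.
  apply: (mulfI (expf_neq0 n m0)).
  by rewrite mxE tofracM tofracXn invfM mulrCA mulVKf ?expf_neq0.
have UnQs : U (~` [set n | (P n : set D) s]) by apply/ultraNP.
apply: filterS UnQs => n nPs; rewrite /=.
by apply: (localization_sub_val (Q := P n) (valF _ (FV n))); last by exists a, s.
Qed.

End Domain.

Theorem theorem5p11 (D : idomainType) (D_int_closed : integrally_closed D) :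
  (noetherian_space (Zar_min (base_ring D)) <->
     noetherian_space (Max D) /\
     (forall M : Spec D, Max D M ->
        noetherian_space (Zar_min (localization M)))) /\
  (noetherian_space (Zar (base_ring D)) <->
     noetherian_space (Spec D) /\
     (forall M : Spec D, Max D M ->
        noetherian_space (Zar (localization M)))).
Proof.
rewrite noetherian_Zar_minP noetherian_ZarP noetherian_MaxP noetherian_SpecP.
split; split.
- move=> noeth; split=> [|M maxM].
    apply: (noetherian_primes_centers noeth) => P maxP.
    by have [V minV VP] := ex_minimal_centered maxP; exists V; split=> //; case: minV.
  apply/noetherian_Zar_minP; apply: sub_noetherian_family noeth => V.
  by case/(minimal_localizationP _ maxM).
- move=> [noethMax noethM].
  have noethmin M : Max D M ->
      noetherian_family (minimal_overring (localization M)).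
    by move=> /noethM/noetherian_Zar_minP.
  apply: (noetherian_glue (valF := fun V (minV : minimal_overring _ V) => minV.1)
    D_int_closed noethMax) => //.
    by move=> V minV; exact: Max_center.
  move=> M maxM; apply: sub_noetherian_family (noethmin M maxM) => V.
  by move/(minimal_localizationP _ maxM).
- move=> noeth; split=> [|M _].
    apply: (noetherian_primes_centers noeth) => P _.
    by have [V valV VP] := ex_centered P; exists V.
  apply/noetherian_ZarP; apply: sub_noetherian_family noeth => V.
  by case/valuation_overring_localizationP.
- move=> [noethSpec noethM].
  have noethval M : Max D M ->
      noetherian_family (valuation_overring (localization M)).
    by move=> /noethM/noetherian_ZarP.
  apply: (noetherian_glue (valF := fun V valV => valV)
    D_int_closed noethSpec) => //.
    by move=> M /noethval; apply: sub_noetherian_family => V [].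
  move=> M maxM; apply: sub_noetherian_family (noethval M maxM) => V.
  by move/valuation_overring_localizationP.
Qed.
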